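(* For any Hopf algebra $U$, $U$-equivariant first-order codifferential calculi over $U$ are, up to isomorphism, in bijective correspondence with subspaces $T\subseteq U^+=\ker(\varepsilon)$ such that $$\Delta(T)\subseteq(T\oplus k1)\otimes U.$$ More precisely, given a subspace $T\subseteq U^+$ with $\Delta(T)\subseteq(T\oplus k1)\otimes U$, $U\otimes T$ is a first-order codifferential calculus with codifferential $$\delta^T\colon U\otimes T\to U,\quad x\otimes t\mapsto xt.$$
   Context: $k$ is a field with $\mathrm{char}(k)\ne2$; everything is over $k$. $U$ is regarded as a left $U$-module coalgebra over itself by left multiplication. In a $U$-bicomodule $W$ write $w_{(-1)}\otimes w_{(0)}$ and $w_{(0)}\otimes w_{(1)}$ for the left and right $U$-coactions. A first-order codifferential calculus (FOCC) over the coalgebra $U$ is a $U$-bicomodule $\mathscr{W}_1$ with a linear map $\delta\colon\mathscr{W}_1\to U$ such that $\Delta(\delta(w))=\delta(w_{(0)})\otimes w_{(1)}+w_{(-1)}\otimes\delta(w_{(0)})$ and $w\mapsto w_{(-1)}\otimes\delta(w_{(0)})\in U\otimes U$ is injective. It is $U$-equivariant if $\mathscr{W}_1$ is also a left $U$-module with $(xw)_{(-1)}\otimes(xw)_{(0)}=x_{(1)}w_{(-1)}\otimes x_{(2)}w_{(0)}$ and $(xw)_{(0)}\otimes(xw)_{(1)}=x_{(1)}w_{(0)}\otimes x_{(2)}w_{(1)}$, and $\delta$ is $U$-linear. Isomorphisms are $U$-linear bicolinear bijections commuting with the coderivations. For a subspace $T\subseteq U^+$ with $\Delta(T)\subseteq(T\oplus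 k1)\otimes U$, $U\otimes T$ has left $U$-action on the first factor, left coaction $x\otimes t\mapsto x_{(1)}\otimes(x_{(2)}\otimes t)$ and right coaction $x\otimes t\mapsto(x_{(1)}\otimes t_{(1)}^+)\otimes x_{(2)}t_{(2)}$, where $t^+=t-\varepsilon(t)1$. *)

(* Defs.v *)
From HB Require Import structures.
From mathcomp Require Import all_boot all_algebra.
From mathcomp Require Import sesquilinear boolp.

Set Implicit Arguments.
Unset Strict Implicit.
Unset Printing Implicit Defensive.

Import GRing.Theory.
Local Open Scope ring_scope.
Local Open Scope quotient_scope.

Reserved Notation "V ⊗ W" (at level 40, left associativity).

Notation bilinear f := (bilinear_for *:%R *:%R f).

(******************************************************************************)
(*  Tensor product of two arbitrary modules over a commutative ring: formal   *)
(*  sums of pairs (a list (v_1, w_1), ..., (v_n, w_n) stands for the sum of   *)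
(*  the v_i ⊗ w_i) modulo the congruence generated by bilinearity.            *)
(******************************************************************************)

Section TensorDef.
Variables (R : comNzRingType) (V W : lmodType R).
Implicit Types (s t : seq (V * W)) (v : V) (w : W) (c : R).

Inductive tensor_eq : seq (V * W) -> seq (V * W) -> Prop :=
| TensorRefl s : tensor_eq s s
| TensorSym s t : tensor_eq s t -> tensor_eq t s
| TensorTrans s t u : tensor_eq s t -> tensor_eq t u -> tensor_eq s u
| TensorCat s s' t t' :
    tensor_eq s s' -> tensor_eq t t' -> tensor_eq (s ++ t) (s' ++ t')
| TensorCatC s t : tensor_eq (s ++ t) (t ++ s)
| Tensor0 w : tensor_eq [:: (0, w)] [::]
| TensorDl v v' w : tensor_eq [:: (v + v', w)] [:: (v, w); (v', w)]
| TensorDr v w w' : tensor_eq [:: (v, w + w')] [:: (v, w); (v, w')]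
| TensorZ c v w : tensor_eq [:: (c *: v, w)] [:: (v, c *: w)].

Definition tensor_eqb s t := `[< tensor_eq s t >].

Lemma tensor_eqb_equiv : equiv_class_of tensor_eqb.
Proof.
split=> [s|s t|t s u].
- by apply/asboolP; apply: TensorRefl.
- by apply/asboolP/asboolP; apply: TensorSym.
- by move=> /asboolP st /asboolP tu; apply/asboolP; apply: TensorTrans st tu.
Qed.

Canonical tensor_equiv := EquivRelPack tensor_eqb_equiv.

Definition tensor := {eq_quot tensor_equiv}.

HB.instance Definition _ := Choice.on tensor.
HB.instance Definition _ := EqQuotient.on tensor.

Implicit Types a b : tensor.

Definition tensor_of s : tensor := \pi s.

Lemma tensor_ofP s t : tensor_of s = tensor_of t <-> tensor_eq s t.
Proof.
split=> [/eqP|st]; first by rewrite eqmodE => /asboolP.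
by apply/eqP; rewrite eqmodE; apply/asboolP.
Qed.

Lemma tensor_reprK a : tensor_of (repr a) = a.
Proof. exact: reprK. Qed.

Lemma tensor_repr_of s : tensor_eq (repr (tensor_of s)) s.
Proof. by apply/tensor_ofP; rewrite tensor_reprK. Qed.

Definition tensor_scale_seq c s := [seq (c *: p.1, p.2) | p <- s].

Lemma tensor_scale_seq_eq c s t :
  tensor_eq s t -> tensor_eq (tensor_scale_seq c s) (tensor_scale_seq c t).
Proof.
elim=> {s t} /=.
- by move=> s; apply: TensorRefl.
- by move=> s t _; apply: TensorSym.
- by move=> s t u _ st _; apply: TensorTrans.
- move=> s s' t t' _ ss' _ tt'; rewrite /tensor_scale_seq !map_cat.
  exact: TensorCat.
- by move=> s t; rewrite /tensor_scale_seq !map_cat; apply: TensorCatC.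
- by move=> w; rewrite scaler0; apply: Tensor0.
- by move=> v v' w; rewrite scalerDr; apply: TensorDl.
- by move=> v w w'; apply: TensorDr.
- by move=> d v w; rewrite scalerA mulrC -scalerA; apply: TensorZ.
Qed.

Definition tensor_zero : tensor := tensor_of [::].
Definition tensor_add a b : tensor := tensor_of (repr a ++ repr b).
Definition tensor_scale c a : tensor := tensor_of (tensor_scale_seq c (repr a)).
Definition tensor_opp a : tensor := tensor_scale (-1) a.

Lemma tensor_add_of s t :
  tensor_add (tensor_of s) (tensor_of t) = tensor_of (s ++ t).
Proof. by apply/tensor_ofP; apply: TensorCat; apply: tensor_repr_of. Qed.

Lemma tensor_scale_of c s :
  tensor_scale c (tensor_of s) = tensor_of (tensor_scale_seq c s).
Proof. by apply/tensor_ofP; apply/tensor_scale_seq_eq/tensor_repr_of. Qed.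

Lemma tensor_ofK_ind (P : tensor -> Prop) :
  (forall s, P (tensor_of s)) -> forall a, P a.
Proof. by move=> Ps a; rewrite -[a]tensor_reprK. Qed.

Lemma tensor_addA : associative tensor_add.
Proof.
elim/tensor_ofK_ind=> s; elim/tensor_ofK_ind=> t; elim/tensor_ofK_ind=> u.
by rewrite !tensor_add_of catA.
Qed.

Lemma tensor_addC : commutative tensor_add.
Proof.
elim/tensor_ofK_ind=> s; elim/tensor_ofK_ind=> t; rewrite !tensor_add_of.
by apply/tensor_ofP; apply: TensorCatC.
Qed.

Lemma tensor_add0 : left_id tensor_zero tensor_add.
Proof. by elim/tensor_ofK_ind=> s; rewrite tensor_add_of. Qed.

Lemma tensor_scaleDl a : {morph tensor_scale^~ a : c d / c + d >-> tensor_add c d}.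
Proof.
elim/tensor_ofK_ind: a => s c d; rewrite !tensor_scale_of tensor_add_of.
apply/tensor_ofP; elim: s => [|[v w] s IHs] /=; first exact: TensorRefl.
rewrite scalerDl.
apply: (@TensorTrans _ ([:: (c *: v, w); (d *: v, w)] ++
   (tensor_scale_seq c s ++ tensor_scale_seq d s))).
  by apply: (@TensorCat [:: _]) => //; apply: TensorDl.
apply: (@TensorCat [:: _] [:: _]); first exact: TensorRefl.
rewrite -[(_ :: _ ++ tensor_scale_seq d s)]cat1s -[_ :: tensor_scale_seq d s]cat1s.
rewrite !catA; apply: TensorCat; last exact: TensorRefl.
exact: TensorCatC.
Qed.

Lemma tensor_scale0 a : tensor_scale 0 a = tensor_zero.
Proof.
elim/tensor_ofK_ind: a => s; rewrite tensor_scale_of; apply/tensor_ofP.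
elim: s => [|[v w] s IHs] /=; first exact: TensorRefl.
by rewrite scale0r; apply: (@TensorCat [:: _] [::]) => //; apply: Tensor0.
Qed.

Lemma tensor_scale1 : left_id 1 tensor_scale.
Proof.
elim/tensor_ofK_ind=> s; rewrite tensor_scale_of; congr tensor_of.
by rewrite -[RHS]map_id; apply: eq_map => -[v w]; rewrite /= scale1r.
Qed.

Lemma tensor_addN : left_inverse tensor_zero tensor_opp tensor_add.
Proof.
move=> a; rewrite -{2}[a]tensor_scale1 -tensor_scaleDl addNr.
exact: tensor_scale0.
Qed.

HB.instance Definition _ :=
  GRing.isZmodule.Build tensor tensor_addA tensor_addC tensor_add0 tensor_addN.

Lemma tensor_scaleA c d a :
  tensor_scale c (tensor_scale d a) = tensor_scale (c * d) a.
Proof.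
elim/tensor_ofK_ind: a => s; rewrite !tensor_scale_of; congr tensor_of.
by rewrite /tensor_scale_seq -map_comp; apply: eq_map => -[v w]; rewrite /= scalerA.
Qed.

Lemma tensor_scaleDr : right_distributive tensor_scale +%R.
Proof.
move=> c; elim/tensor_ofK_ind=> s; elim/tensor_ofK_ind=> t.
apply: etrans (_ : tensor_scale c (tensor_of (s ++ t)) = _).
  by congr tensor_scale; apply: tensor_add_of.
rewrite !tensor_scale_of /tensor_scale_seq map_cat.
exact/esym/tensor_add_of.
Qed.

HB.instance Definition _ :=
  GRing.Zmodule_isLmodule.Build R tensor
    tensor_scaleA tensor_scale1 tensor_scaleDr tensor_scaleDl.

Lemma tensor_ofD s t : tensor_of (s ++ t) = tensor_of s + tensor_of t.
Proof. exact/esym/tensor_add_of. Qed.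

Lemma tensor_ofZ c s : tensor_of (tensor_scale_seq c s) = c *: tensor_of s.
Proof. exact/esym/tensor_scale_of. Qed.

Definition tens v w : tensor := tensor_of [:: (v, w)].

Lemma tens_bilinear : bilinear tens.
Proof.
have tensZ c v w : tens (c *: v) w = c *: tens v w by rewrite -tensor_ofZ.
split=> [w c v v'|v c w w'] /=; rewrite -tensZ -tensor_ofD /=.
  by apply/tensor_ofP; apply: TensorDl.
apply/tensor_ofP; apply: TensorTrans (TensorDr _ _ _) _.
apply: (@TensorCat [:: _] [:: _]); last exact: TensorRefl.
exact/TensorSym/TensorZ.
Qed.

HB.instance Definition _ :=
  bilinear_isBilinear.Build R V W tensor *:%R *:%R tens tens_bilinear.

Lemma tensor_sum a : a = \sum_(p <- repr a) tens p.1 p.2.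
Proof.
rewrite -[LHS]tensor_reprK; elim: (repr a) => [|[v w] s IHs].
  by rewrite big_nil.
by rewrite big_cons -IHs -tensor_ofD.
Qed.

(* The map induced on the tensor product by f; it is meaningful only when f   *)
(* is bilinear, in which case it is characterized by tlift_tens and           *)
(* tlift_linear below.                                                        *)
Definition tlift (P : lmodType R) (f : V -> W -> P) (a : tensor) : P :=
  \sum_(p <- repr a) f p.1 p.2.

Section Universal.
Variables (P : lmodType R) (f : V -> W -> P).
Hypothesis f_bilinear : bilinear f.

Let F : {bilinear V -> W -> P} :=
  HB.pack f (bilinear_isBilinear.Build R V W P *:%R *:%R f f_bilinear).

Lemma tlift_of s : tlift f (tensor_of s) = \sum_(p <- s) f p.1 p.2.
Proof.
suff eq_sum s' t : tensor_eq s' t ->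
    \sum_(p <- s') f p.1 p.2 = \sum_(p <- t) f p.1 p.2.
  exact/eq_sum/tensor_repr_of.
elim=> {s s' t} //=.
- by move=> s t u _ -> _ ->.
- by move=> s s' t t' _ e _ e'; rewrite !big_cat /= e e'.
- by move=> s t; rewrite !big_cat /= addrC.
- by move=> w; rewrite big_seq1 big_nil (linear0l F w : f 0 w = 0).
- by move=> v v' w; rewrite !(big_cons, big_nil) !addr0
     (linearDl F w v v' : f (v + v') w = _).
- by move=> v w w'; rewrite !(big_cons, big_nil) !addr0
     (linearDr F v w w' : f v (w + w') = _).
- by move=> c v w; rewrite !big_seq1
     (linearZl_LR F w c v : f (c *: v) w = _)
     (linearZr_LR F v c w : f v (c *: w) = _).
Qed.

Lemma tlift_tens v w : tlift f (tens v w) = f v w.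
Proof. by rewrite tlift_of big_seq1. Qed.

Lemma tlift_linear : linear (tlift f).
Proof.
move=> c; elim/tensor_ofK_ind=> s; elim/tensor_ofK_ind=> t.
rewrite -tensor_ofZ -tensor_ofD !tlift_of big_cat /=.
congr (_ + _); rewrite big_map scaler_sumr; apply: eq_bigr => p _.
by rewrite -(linearZl_LR F p.2 c p.1 : f (c *: p.1) p.2 = _).
Qed.

End Universal.

Lemma tensor_ext (P : lmodType R) (f g : {linear tensor -> P}) :
  (forall v w, f (tens v w) = g (tens v w)) -> f =1 g.
Proof.
move=> fg a; rewrite (tensor_sum a) !linear_sum.
by apply: eq_bigr => p _; apply: fg.
Qed.

End TensorDef.

Notation "V ⊗ W" := (tensor V%type W%type) : type_scope.
Notation "v ⊗ w" := (tens v w) : ring_scope.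

Section TensorMaps.
Variable R : comNzRingType.
Implicit Types A B C D V W P : lmodType R.

Definition tmap V W A B (f : V -> A) (g : W -> B) : V ⊗ W -> A ⊗ B :=
  tlift (fun v w => f v ⊗ g w).

Section TmapLinear.
Variables (V W A B : lmodType R) (f : {linear V -> A}) (g : {linear W -> B}).

Lemma tmap_bilinear : bilinear (fun v w => f v ⊗ g w).
Proof.
by split=> [w c v v'|v c w w']; rewrite linearP ?linearPl ?linearPr.
Qed.

Lemma tmap_tens v w : tmap f g (v ⊗ w) = f v ⊗ g w.
Proof. exact: (tlift_tens tmap_bilinear). Qed.

HB.instance Definition _ :=
  GRing.isLinear.Build R (V ⊗ W)%type (A ⊗ B)%type *:%R (tmap f g)
    (tlift_linear tmap_bilinear).
End TmapLinear.

Section Assoc.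
Variables A B C : lmodType R.

Definition tassoc : (A ⊗ B) ⊗ C -> A ⊗ (B ⊗ C) :=
  tlift (fun p c => tlift (fun a b => a ⊗ (b ⊗ c)) p).

Lemma tassoc_bilinear1 (c : C) : bilinear (fun (a : A) (b : B) => a ⊗ (b ⊗ c)).
Proof. by split=> [b d a a'|a d b b']; rewrite ?linearPl ?linearPr. Qed.

Lemma tassoc_bilinear :
  bilinear (fun (p : A ⊗ B) (c : C) => tlift (fun a b => a ⊗ (b ⊗ c)) p).
Proof.
split=> [c|p d c c']; first exact: tlift_linear (tassoc_bilinear1 c).
rewrite /tlift /= scaler_sumr -big_split; apply: eq_bigr => -[a b] _ /=.
by rewrite !linearPr.
Qed.

Lemma tassoc_tens a b c : tassoc ((a ⊗ b) ⊗ c) = a ⊗ (b ⊗ c).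
Proof.
rewrite /tassoc (tlift_tens tassoc_bilinear).
exact: (tlift_tens (tassoc_bilinear1 c)).
Qed.

HB.instance Definition _ :=
  GRing.isLinear.Build R ((A ⊗ B) ⊗ C)%type (A ⊗ (B ⊗ C))%type *:%R tassoc
    (tlift_linear tassoc_bilinear).
End Assoc.

Section Interchange.
Variables A B C D : lmodType R.

Definition tinterchange : (A ⊗ B) ⊗ (C ⊗ D) -> (A ⊗ C) ⊗ (B ⊗ D) :=
  tlift (fun p q =>
    tlift (fun a b => tlift (fun c d => (a ⊗ c) ⊗ (b ⊗ d)) q) p).

Let f1 (a : A) (b : B) := fun (c : C) (d : D) => (a ⊗ c) ⊗ (b ⊗ d).

Lemma tinterchange_bilinear1 a b : bilinear (f1 a b).
Proof. by rewrite /f1; split=> [d e c c'|c e d d']; rewrite !(linearPl, linearPr). Qed.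

Lemma tinterchange_bilinear2 (q : C ⊗ D) :
  bilinear (fun (a : A) (b : B) => tlift (f1 a b) q).
Proof.
split=> [b e a a'|a e b b'];
  rewrite /tlift /= scaler_sumr -big_split; apply: eq_bigr => -[c d] _ /=;
  by rewrite /f1 !(linearPl, linearPr).
Qed.

Lemma tinterchange_bilinear3 :
  bilinear (fun (p : A ⊗ B) (q : C ⊗ D) => tlift (fun a b => tlift (f1 a b) q) p).
Proof.
split=> [q|p e q q']; first exact: tlift_linear (tinterchange_bilinear2 q).
rewrite {1 2 4}/tlift /= scaler_sumr -big_split; apply: eq_bigr => -[a b] _.
exact: (tlift_linear (tinterchange_bilinear1 a b)).
Qed.

Lemma tinterchange_tens a b c d :
  tinterchange ((a ⊗ b) ⊗ (c ⊗ d)) = (a ⊗ c) ⊗ (b ⊗ d).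
Proof.
rewrite /tinterchange (tlift_tens tinterchange_bilinear3).
rewrite (tlift_tens (tinterchange_bilinear2 _)).
exact: (tlift_tens (tinterchange_bilinear1 a b)).
Qed.

HB.instance Definition _ :=
  GRing.isLinear.Build R
    ((A ⊗ B) ⊗ (C ⊗ D))%type ((A ⊗ C) ⊗ (B ⊗ D))%type *:%R tinterchange
    (tlift_linear tinterchange_bilinear3).
End Interchange.
End TensorMaps.

(* The maps c ⊗ w |-> e(c) w and w ⊗ c |-> e(c) w, for a linear form e.       *)
Section TensorScalar.
Variables (k : fieldType) (C W : lmodType k) (e : C -> k).
Definition tscalel : C ⊗ W -> W := tlift (fun c w => e c *: w).
Definition tscaler : W ⊗ C -> W := tlift (fun w c => e c *: w).
End TensorScalar.

(******************************************************************************)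
(*  Coalgebras and Hopf algebras, of arbitrary dimension                      *)
(******************************************************************************)

HB.mixin Record Lmodule_isCoalgebra (k : fieldType) C of GRing.Lmodule k C := {
  comul : {linear C -> (C ⊗ C)%type};
  counit : {scalar C};
  comulA : forall x : C,
    tassoc (tmap comul idfun (comul x)) = tmap idfun comul (comul x);
  counitl : forall x : C, tscalel counit (comul x) = x;
  counitr : forall x : C, tscaler counit (comul x) = x
}.

#[short(type="coalgType")]
HB.structure Definition Coalgebra (k : fieldType) :=
  {C of Lmodule_isCoalgebra k C & GRing.Lmodule k C}.

Definition tmul (k : fieldType) (U : algType k) : U ⊗ U -> U :=
  tlift (fun x y => x * y).

HB.mixin Record Coalgebra_isHopf (k : fieldType) U
    of GRing.Algebra k U & Coalgebra k U := {
  antipode : {linear U -> U};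
  comulM : forall x y : U, comul (x * y) =
    tmap (@tmul k U) (@tmul k U) (tinterchange (comul x ⊗ comul y));
  comul1 : comul (1 : U) = 1 ⊗ 1;
  counitM : forall x y : U, counit (x * y) = counit x * counit y;
  counit1 : counit (1 : U) = 1;
  antipodel : forall x : U, tmul (tmap antipode idfun (comul x)) = (counit x)%:A;
  antipoder : forall x : U, tmul (tmap idfun antipode (comul x)) = (counit x)%:A
}.

#[short(type="hopfAlgType")]
HB.structure Definition HopfAlgebra (k : fieldType) :=
  {U of GRing.Algebra k U & Coalgebra k U & Coalgebra_isHopf k U}.

(******************************************************************************)
(*  First-order codifferential calculi (FOCC) over a coalgebra, and           *)
(*  equivariant ones (EFOCC) over a Hopf algebra. The records *_data carry    *)
(*  only the structure maps; all axioms are in the predicates is_*.           *)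
(******************************************************************************)

Section Bicomodule.
Variables (k : fieldType) (C : coalgType k) (W : lmodType k).
Variables (lco : W -> C ⊗ W) (rco : W -> W ⊗ C).

Record is_bicomodule : Prop := {
  lco_linear : linear lco;
  rco_linear : linear rco;
  lcoA : forall w, tassoc (tmap comul idfun (lco w)) = tmap idfun lco (lco w);
  lco_counit : forall w, tscalel counit (lco w) = w;
  rcoA : forall w, tassoc (tmap rco idfun (rco w)) = tmap idfun comul (rco w);
  rco_counit : forall w, tscaler counit (rco w) = w;
  lco_rco : forall w, tassoc (tmap lco idfun (rco w)) = tmap idfun rco (lco w)
}.
End Bicomodule.

Record focc_data (k : fieldType) (C : coalgType k) := FoccData {
  focc_space :> lmodType k;
  lcoact : focc_space -> C ⊗ focc_space;
  rcoact : focc_space -> focc_space ⊗ C;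
  codiff : focc_space -> C
}.

Record is_focc (k : fieldType) (C : coalgType k) (W : focc_data C) : Prop := {
  focc_bicomodule : is_bicomodule (@lcoact k C W) (@rcoact k C W);
  codiff_linear : linear (@codiff k C W);
  codiff_coderivation : forall w : W,
    comul (codiff w) =
      tmap (@codiff k C W) idfun (rcoact w) + tmap idfun (@codiff k C W) (lcoact w);
  codiff_injective :
    injective (fun w : W => tmap idfun (@codiff k C W) (lcoact w))
}.

Record efocc_data (k : fieldType) (U : hopfAlgType k) := EfoccData {
  efocc_focc :> focc_data U;
  act : U -> efocc_focc -> efocc_focc
}.

Section Equivariant.
Variables (k : fieldType) (U : hopfAlgType k).

Record is_efocc (W : efocc_data U) : Prop := {
  efocc_is_focc : is_focc W;
  act_bilinear1 : forall w : W, linear (fun x : U => act x w);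
  act_bilinear2 : forall x : U, linear (@act k U W x);
  act1 : forall w : W, act 1 w = w;
  actM : forall (x y : U) (w : W), act (x * y) w = act x (act y w);
  act_lcoact : forall (x : U) (w : W),
    lcoact (act x w) =
      tmap (@tmul k U) (tlift (@act k U W)) (tinterchange (comul x ⊗ lcoact w));
  act_rcoact : forall (x : U) (w : W),
    rcoact (act x w) =
      tmap (tlift (@act k U W)) (@tmul k U) (tinterchange (comul x ⊗ rcoact w));
  act_codiff : forall (x : U) (w : W), codiff (act x w) = x * codiff w
}.

Definition efocc_iso (W W' : efocc_data U) : Prop :=
  exists f : {linear W -> W'},
    [/\ bijective f,
        forall (x : U) (w : W), f (act x w) = act x (f w),
        forall w : W, lcoact (f w) = tmap idfun f (lcoact w),
        forall w : W, rcoact (f w) = tmap f idfun (rcoact w)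
      & forall w : W, codiff (f w) = codiff w].

End Equivariant.

(******************************************************************************)
(*  The calculus U ⊗ T                                                        *)
(******************************************************************************)

Section SubspaceType.
Variables (k : fieldType) (V : lmodType k) (T : submodClosed V).

Record sub_of : predArgType := SubOf { sub_val :> V; _ : sub_val \in T }.

HB.instance Definition _ := [isSub of sub_of for sub_val].
HB.instance Definition _ := [Choice of sub_of by <:].
HB.instance Definition _ := [SubChoice_isSubLmodule of sub_of by <:].

Lemma sub_val_linear : linear sub_val.
Proof. exact: (linearP (\val : sub_of -> V)). Qed.

HB.instance Definition _ :=
  GRing.isLinear.Build k sub_of V *:%R sub_val sub_val_linear.
End SubspaceType.

(* The image of A ⊗ W in V ⊗ W, for a subspace A of V.                        *)
Definition tensor_subl (k : fieldType) (V W : lmodType k) (A : V -> Prop)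
    (a : V ⊗ W) : Prop :=
  exists s : seq (V * W),
    (forall p, p \in s -> A p.1) /\ a = \sum_(p <- s) p.1 ⊗ p.2.

Section FoccOfSubspace.
Variables (k : fieldType) (U : hopfAlgType k).

(* Membership in T + k1; the sum is direct when T lies in the kernel of the   *)
(* counit.                                                                    *)
Definition add_unit (T : submodClosed U) (x : U) : Prop :=
  exists t c, t \in T /\ x = t + c%:A.

Record focc_subspace := FoccSubspace {
  fsub :> submodClosed U;
  fsub_augmentation : forall t : U, t \in fsub -> counit t = 0;
  fsub_comul : forall t : U,
    t \in fsub -> tensor_subl (add_unit fsub) (comul t)
}.

Definition aug_part (x : U) : U := x - (counit x)%:A.

Lemma aug_part_linear : linear aug_part.
Proof.
move=> c x y; rewrite /aug_part linearP scalerDl -scalerA scalerBr.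
by rewrite opprD addrACA.
Qed.

HB.instance Definition _ :=
  GRing.isLinear.Build k U U *:%R aug_part aug_part_linear.

Variable T : focc_subspace.

Lemma fsub_coact_exists (t : sub_of T) :
  exists u : sub_of T ⊗ U, tmap (@sub_val k U T) idfun u =
    tmap aug_part idfun (comul (sub_val t)).
Proof.
have [s [sT ->]] := fsub_comul (valP t).
elim: s sT => [|[x y] s IHs] sT.
  by exists 0; rewrite big_nil !linear0.
have [|u def_u] := IHs; first by move=> p sp; apply: sT; rewrite inE sp orbT.
have [|r [c [Tr def_x]]] := sT (x, y); first by rewrite inE eqxx.
exists ((SubOf Tr : sub_of T) ⊗ y + u).
have aug_x : aug_part x = r.
  have eps1 : counit (c%:A : U) = c.
    by rewrite linearZ /= counit1 mulr1.
  rewrite /= in def_x; rewrite def_x /aug_part linearD eps1.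
  by rewrite (fsub_augmentation Tr) add0r addrK.
by rewrite big_cons !linearD /= def_u !tmap_tens /= aug_x.
Qed.

(* The element t_(1)^+ ⊗ t_(2), viewed in T ⊗ U: it is the unique preimage of *)
(* t_(1)^+ ⊗ t_(2) in U ⊗ U, as the map T ⊗ U -> U ⊗ U induced by the         *)
(* inclusion of T in U is injective (k being a field).                        *)
Definition fsub_coact (t : sub_of T) : sub_of T ⊗ U :=
  projT1 (cid (fsub_coact_exists t)).

Lemma fsub_coactP (t : sub_of T) :
  tmap (@sub_val k U T) idfun (fsub_coact t) =
    tmap aug_part idfun (comul (sub_val t)).
Proof. exact: projT2 (cid (fsub_coact_exists t)). Qed.

Definition focc_of : efocc_data U :=
  @EfoccData k U
    (@FoccData k U (U ⊗ sub_of T)%type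
       (fun w => tassoc (tmap comul idfun w))
       (tlift (fun x t =>
          tmap idfun (@tmul k U) (tinterchange (comul x ⊗ fsub_coact t))))
       (tlift (fun x t => x * sub_val t)))
    (fun x => tmap (fun y => x * y) idfun).

End FoccOfSubspace.

(* Main.v *)
From HB Require Import structures.
From mathcomp Require Import all_boot all_algebra.
From mathcomp Require Import sesquilinear boolp classical_sets.
(* Imported last, so that its notation bilinear prevails.                     *)
Require Import Defs.

Set Implicit Arguments.
Unset Strict Implicit.
Unset Printing Implicit Defensive.

Import GRing.Theory.
Local Open Scope ring_scope.

(** The correspondence is the fundamental theorem of Hopf modules, transported
    along the coderivation.  An equivariant calculus W is in particular a left
    Hopf module over U, hence W is U ⊗ V, where V is the space of left
    coinvariants (the v with left coaction 1 ⊗ v), and the projection of W on V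
    is w |-> S(w_(-1)) w_(0) (lco_coinv_proj, act_coinv_proj).  On V the
    injectivity axiom says exactly that the coderivation d is injective, since
    w_(-1) ⊗ d(w_(0)) = 1 ⊗ d(w) there; so V is identified with T = d(V).  For v
    in V the coderivation rule reads Delta(d(v)) = d(v_(0)) ⊗ v_(1) + 1 ⊗ d(v).
    The right coaction preserves V (rco_coinv), so this puts Delta(T) in
    (T + k1) ⊗ U, and it also determines the right coaction: in terms of
    t = d(v) it must be t_(1)^+ ⊗ t_(2).  Applying the counit to the same rule
    on W gives epsilon(d(w)) = 2 epsilon(d(w)), so that T lies in the kernel of
    the counit.

    In the other direction, U ⊗ T satisfies the injectivity axiom because
    x ⊗ t |-> x_(1) ⊗ x_(2) t is the restriction to U ⊗ T of a bijection of
    U ⊗ U, with inverse y ⊗ z |-> y_(1) ⊗ S(y_(2)) z (calc_codiff_injective).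
    The same injectivity shows that the comparison map U ⊗ T -> W,
    x ⊗ d(v) |-> x v, is injective (reconstruction_iso).  Finally T is recovered
    from U ⊗ T as the image under the coderivation of the coinvariants, which
    are the 1 ⊗ t (calc_coinv); this is invariant under isomorphism.

    Two devices carry the computations.  Sweedler sums are written with tlift:
    the sum of the F(x_(1), x_(2)) is tlift F (comul x), and every
    coassociativity law in play is an instance of tlift_assoc.  Subspaces T of V
    give injective maps T ⊗ W -> V ⊗ W because T has a complement in V, by
    Zorn's lemma (complement_exists). *)

(** * Linearity of nested tensor expressions *)

Section Linearity.
Variables (R : comNzRingType) (A B V W P : lmodType R).

Lemma lin_id : linear (fun x : V => x).
Proof. by []. Qed.

Lemma lin_comp (g : {linear A -> P}) (f : V -> A) :
  linear f -> linear (fun x => g (f x)).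
Proof. by move=> lf c u v; rewrite lf linearP. Qed.

Lemma lin_tensl (f : V -> A) (b : B) : linear f -> linear (fun x => f x ⊗ b).
Proof. by move=> lf c u v; rewrite lf linearPl. Qed.

Lemma lin_tensr (f : V -> B) (a : A) : linear f -> linear (fun x => a ⊗ f x).
Proof. by move=> lf c u v; rewrite lf linearPr. Qed.

Lemma lin_scale (c : R) (f : V -> P) : linear f -> linear (fun x => c *: f x).
Proof.
by move=> lf d u v; rewrite lf scalerDr !scalerA [c * d]mulrC.
Qed.

Lemma lin_scalel (g : {scalar A}) (f : V -> A) (p : P) :
  linear f -> linear (fun x => g (f x) *: p).
Proof. by move=> lf d u v; rewrite lf linearP scalerDl scalerA. Qed.

Lemma lin_tlift_fun (F : V -> A -> B -> P) (a : A ⊗ B) :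
  (forall y z, linear (fun x => F x y z)) -> linear (fun x => tlift (F x) a).
Proof.
move=> lF c u v; rewrite /tlift scaler_sumr -big_split; apply: eq_bigr => p _.
exact: lF.
Qed.

Lemma lin_tlift_arg (F : A -> B -> P) (f : V -> A ⊗ B) :
  bilinear F -> linear f -> linear (fun x => tlift F (f x)).
Proof. by move=> bF lf c u v; rewrite lf (tlift_linear bF). Qed.

Lemma lin_bill (F : {bilinear A -> B -> P}) (f : V -> A) (b : B) :
  linear f -> linear (fun x => F (f x) b).
Proof. by move=> lf c u v; rewrite lf linearPl. Qed.

Lemma lin_bilr (F : {bilinear A -> B -> P}) (f : V -> B) (a : A) :
  linear f -> linear (fun x => F a (f x)).
Proof. by move=> lf c u v; rewrite lf linearPr. Qed.

Lemma lin_tmap_arg (g : {linear A -> V}) (h : {linear B -> W})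
    (f : P -> A ⊗ B) :
  linear f -> linear (fun x => tmap g h (f x)).
Proof. by move=> lf c u v; rewrite lf linearP. Qed.

End Linearity.

Section LinearityAlg.
Variables (k : fieldType) (U : algType k) (V : lmodType k).

Lemma lin_mull (f : V -> U) (y : U) : linear f -> linear (fun x => f x * y).
Proof. by move=> lf c u v; rewrite lf mulrDl scalerAl. Qed.

Lemma lin_mulr (f : V -> U) (y : U) : linear f -> linear (fun x => y * f x).
Proof. by move=> lf c u v; rewrite lf mulrDr scalerAr. Qed.

End LinearityAlg.

Lemma bilinearI (R : comNzRingType) (V W P : lmodType R) (F : V -> W -> P) :
  (forall w, linear (fun v => F v w)) -> (forall v, linear (fun w => F v w)) ->
  bilinear F.
Proof. by split. Qed.

(** One step of lin, which proves linearity in each variable of an expression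
    built from tensors, products, actions, scalings, linear maps and nested
    Sweedler sums.  The syntactic dispatch on the head of the body matters: tassoc, tmap and the
    coactions all unfold to tlift, and unification alone would unfold them. *)
Ltac lin_step :=
  lazymatch goal with
  | |- GRing.linear_for _ (fun x => x) => exact: lin_id
  | |- GRing.linear_for _ (fun x => tens _ _) =>
      first [apply: lin_tensl | apply: lin_tensr]
  | |- GRing.linear_for _ (fun x => GRing.mul _ _) =>
      first [apply: lin_mull | apply: lin_mulr]
  | |- GRing.linear_for _ (fun x => GRing.scale _ _) =>
      first [apply: lin_scalel | apply: lin_scale]
  | |- GRing.linear_for _ (fun x => tlift _ _) =>
      first [ apply: lin_tlift_fun => ? ?
            | apply: lin_tlift_arg; [apply: bilinearI => ? |] ]
  | |- GRing.linear_for _ (fun x => tmap _ _ _) => apply: lin_tmap_arg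
  | |- GRing.linear_for _ (fun x => _) =>
      first [apply: lin_comp | apply: lin_bill | apply: lin_bilr]
  | |- GRing.linear_for _ (tlift _) =>
      apply: tlift_linear; apply: bilinearI => ?
  | |- GRing.linear_for _ (tens ?v) => exact: (lin_tensr v (@lin_id _ _))
  | |- GRing.linear_for _ (GRing.mul ?v) => exact: (lin_mulr v (@lin_id _ _))
  | |- GRing.linear_for _ (GRing.scale ?c) => exact: (lin_scale c (@lin_id _ _))
  | |- _ => first [exact: linearP | exact: (lin_bilr _ (@lin_id _ _))]
  end.
Ltac lin := try apply: bilinearI => ?; repeat lin_step.

(** * Sweedler sums *)

Section TensorSums.
Variable R : comNzRingType.
Implicit Types A B C D V W P : lmodType R.

Lemma tlift_tensE V W (a : V ⊗ W) : tlift (@tens R V W) a = a.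
Proof. exact/esym/tensor_sum. Qed.

Lemma eq_tlift V W P (F G : V -> W -> P) a :
  (forall v w, F v w = G v w) -> tlift F a = tlift G a.
Proof. by move=> FG; apply: eq_bigr => p _; apply: FG. Qed.

Lemma tliftD V W P (F G : V -> W -> P) a :
  tlift (fun v w => F v w + G v w) a = tlift F a + tlift G a.
Proof. exact: big_split. Qed.

Lemma tliftB V W P (F G : V -> W -> P) a :
  tlift (fun v w => F v w - G v w) a = tlift F a - tlift G a.
Proof. exact: sumrB. Qed.

Lemma linear_tlift V W A P (g : {linear A -> P}) (F : V -> W -> A) a :
  g (tlift F a) = tlift (fun v w => g (F v w)) a.
Proof. exact: linear_sum. Qed.

Lemma lin_tlift V W A P (f : A -> P) (F : V -> W -> A) a : linear f ->
  f (tlift F a) = tlift (fun v w => f (F v w)) a.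
Proof.
move=> lf; pose g : {linear A -> P} :=
  HB.pack f (GRing.isLinear.Build R _ _ *:%R _ lf).
exact: (linear_tlift g).
Qed.

Lemma tlift_tensl A V W P (F : V -> W -> A) a (p : P) :
  tlift F a ⊗ p = tlift (fun v w => F v w ⊗ p) a.
Proof. by apply: (lin_tlift (f := fun x => x ⊗ p)); lin. Qed.

Lemma tlift_tensr A V W P (F : V -> W -> A) a (p : P) :
  p ⊗ tlift F a = tlift (fun v w => p ⊗ F v w) a.
Proof. by apply: lin_tlift; lin. Qed.

Lemma exchange_tlift A B V W P (F : A -> B -> V -> W -> P) a c :
  tlift (fun x y => tlift (fun v w => F x y v w) c) a =
  tlift (fun v w => tlift (fun x y => F x y v w) a) c.
Proof. exact: exchange_big. Qed.

Lemma tlift_sum V W A P (F : A -> W -> P) (h : V -> A ⊗ W) (s : seq V) :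
  bilinear F -> tlift F (\sum_(v <- s) h v) = \sum_(v <- s) tlift F (h v).
Proof.
move=> bF; pose G : {linear (A ⊗ W)%type -> P} :=
  HB.pack (tlift F) (GRing.isLinear.Build R _ _ *:%R _ (tlift_linear bF)).
exact: (linear_sum G).
Qed.

Lemma tlift_tlift A B V W P (F : A -> B -> P) (G : V -> W -> A ⊗ B) a :
  bilinear F ->
  tlift F (tlift G a) = tlift (fun v w => tlift F (G v w)) a.
Proof. exact: tlift_sum. Qed.

Lemma tlift_tmap A B V W P (f : V -> A) (g : W -> B) (F : A -> B -> P) a :
  bilinear F -> tlift F (tmap f g a) = tlift (fun v w => F (f v) (g w)) a.
Proof.
move=> bF; rewrite tlift_tlift //; apply: eq_tlift => v w.
by rewrite tlift_tens.
Qed.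

Lemma tassoc_tensl A B C (a : A ⊗ B) (c : C) :
  tassoc (a ⊗ c) = tlift (fun x y => x ⊗ (y ⊗ c)) a.
Proof.
exact: (tlift_tens (@tassoc_bilinear R A B C)).
Qed.

Lemma tinterchangeE A B C D (a : A ⊗ B) (c : C ⊗ D) :
  tinterchange (a ⊗ c) =
  tlift (fun a1 a2 => tlift (fun c1 c2 => (a1 ⊗ c1) ⊗ (a2 ⊗ c2)) c) a.
Proof. exact: (tlift_tens (@tinterchange_bilinear3 R A B C D)). Qed.

Lemma tensor_linear_ext V W P (f g : V ⊗ W -> P) : linear f -> linear g ->
  (forall v w, f (v ⊗ w) = g (v ⊗ w)) -> f =1 g.
Proof.
move=> lf lg fg a.
rewrite -[a]tlift_tensE (lin_tlift _ _ lf) (lin_tlift _ _ lg).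
exact: eq_tlift.
Qed.

Definition trilinear A B C P (F : A -> B -> C -> P) :=
  [/\ forall y z, linear (fun x => F x y z),
      forall x z, linear (fun y => F x y z) & forall x y, linear (F x y)].

(** The general form of coassociativity: when coactions f and g agree after
    iteration, so do the corresponding double Sweedler sums.  It serves for the
    comultiplication and for left and right coactions. *)
Lemma tlift_assoc A B C V W P (f : V -> A ⊗ B) (g : W -> B ⊗ C)
    (F : A -> B -> C -> P) (a : V ⊗ C) (b : A ⊗ W) :
  trilinear F ->
  tassoc (tmap f idfun a) = tmap idfun g b ->
  tlift (fun v c => tlift (fun x y => F x y c) (f v)) a =
  tlift (fun x w => tlift (F x) (g w)) b.
Proof.
case=> F1 F2 F3.
have bF x : bilinear (F x) by split=> [z|y]; [apply: F2|apply: F3].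
have bT : bilinear (fun x (q : B ⊗ C) => tlift (F x) q).
  apply: bilinearI => [q|x]; last exact: tlift_linear.
  by apply: lin_tlift_fun => y z; apply: F1.
move=> /(congr1 (tlift (fun x q => tlift (F x) q))).
rewrite linear_tlift !tlift_tlift // => Efg.
apply: etrans (etrans Efg _); apply: eq_tlift.
  move=> v c; rewrite /= tassoc_tensl tlift_tlift //.
  by apply: eq_tlift => x y; rewrite !tlift_tens.
by move=> x w; rewrite tlift_tens.
Qed.

(** Sweedler sums over a diagonal action, such as Delta(x y) or the coaction
    of x w, split into independent sums over the two arguments. *)
Lemma tlift_interchange A B C D V W P (m : A -> C -> V) (m' : B -> D -> W)
    (F : V -> W -> P) (a : A ⊗ B) (c : C ⊗ D) :
  bilinear m -> bilinear m' -> bilinear F ->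
  tlift F (tmap (tlift m) (tlift m') (tinterchange (a ⊗ c))) =
  tlift (fun a1 a2 => tlift (fun c1 c2 => F (m a1 c1) (m' a2 c2)) c) a.
Proof.
move=> bm bm' bF; rewrite tinterchangeE tlift_tmap //.
have b2 : bilinear (fun x y => F (tlift m x) (tlift m' y)).
  split=> [y|x] e u v /=; rewrite tlift_linear //; [exact: bF.1|exact: bF.2].
rewrite tlift_tlift //; apply: eq_tlift => a1 a2.
rewrite tlift_tlift //; apply: eq_tlift => c1 c2.
by rewrite !tlift_tens.
Qed.
End TensorSums.

(** * Complements of subspaces and flatness *)

Section Complement.
Variables (k : fieldType) (V : lmodType k) (T : submodClosed V).

(** Besides the subspaces that meet T trivially this admits the empty set, so
    that the union of an empty chain qualifies in Zorn's lemma. *)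
Definition transversal (D : set V) :=
  (forall c x y, D x -> D y -> D (c *: x + y)) /\
  (forall x, D x -> x \in T -> x = 0).

(** A maximal transversal D is a complement: if v is not in T + D, then D + kv
    still meets T trivially. *)
Lemma complement_exists : exists D : set V,
  transversal D /\ forall v, exists t d, [/\ t \in T, D d & v = t + d].
Proof.
have [|D [[Dlin DT] Dmax]] := @Zorn_bigcup V transversal.
  move=> F Ftr Ftot; split=> [c x y [X FX Xx] [Y FY Yy]|x [X FX Xx]];
    last first.
    exact: (Ftr X FX).2.
  have [XY|YX] := Ftot X Y FX FY.
    by exists Y => //; apply: (Ftr Y FY).1 => //; apply: XY.
  by exists X => //; apply: (Ftr X FX).1 => //; apply: YX.
(* D0 differs from D only when D is empty. *)
pose D0 : set V := fun x => D x \/ x = 0.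
have D0lin c x y : D0 x -> D0 y -> D0 (c *: x + y).
  case=> [Dx|->]; last by rewrite scaler0 add0r.
  case=> [Dy|->]; first by left; apply: Dlin.
  left; rewrite addr0 -[c](subrK 1) scalerDl scale1r.
  exact: Dlin.
have D0T x : D0 x -> x \in T -> x = 0 by case=> // /DT.
exists D0; split=> [//|v]; apply: contrapT => nv.
pose B : set V := fun x => exists a d, D0 d /\ x = a *: v + d.
apply: (Dmax B); first split.
- by move=> x Dx; exists 0, x; split; [left|rewrite scale0r add0r].
- move=> BD; apply: nv; exists 0, v; rewrite rpred0 add0r; split=> //.
  by left; apply: BD; exists 1, 0; split; [right|rewrite scale1r addr0].
split=> [c _ _ [a [d [Dd ->]]] [b [e [De ->]]]|_ [a [d [Dd ->]]] Tx].
  exists (c * a + b), (c *: d + e); split; first exact: D0lin.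
  by rewrite scalerDr scalerA scalerDl addrACA.
have [a0|a_neq0] := eqVneq a 0.
  by rewrite a0 scale0r add0r in Tx *; apply: D0T.
case: nv; exists (a^-1 *: (a *: v + d)), (- a^-1 *: d); split.
- exact: rpredZ.
- by rewrite -[_ *: d]addr0; apply: D0lin => //; right.
- by rewrite scalerDr scalerA mulVf // scale1r scaleNr addrK.
Qed.

(** The projection along a complement; this is how flatness over a field is
    used below. *)
Lemma sub_val_retraction :
  exists r : {linear V -> sub_of T}, cancel (@sub_val k V T) r.
Proof.
have [D [[Dlin DT] VTD]] := complement_exists.
have /choice [r rP] : forall v, exists t : sub_of T, D (v - sub_val t).
  move=> v; have [t [d [Tt Dd ->]]] := VTD v; exists (SubOf Tt).
  by rewrite /= addrAC subrr add0r.
have r_uniq v (t : sub_of T) : D (v - sub_val t) -> r v = t.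
  move=> Dv; apply: val_inj; apply/eqP; rewrite -subr_eq0; apply/eqP.
  apply: DT; last first.
    by rewrite -scaleN1r; apply: rpredD; [|apply: rpredZ]; apply: valP.
  have -> : \val (r v) - \val t = -1 *: (v - sub_val (r v)) + (v - sub_val t).
    by rewrite scaleN1r opprB addrA subrK.
  exact: Dlin.
have r_lin : linear r.
  move=> c u v; apply: r_uniq; rewrite sub_val_linear opprD addrACA -scalerBr.
  exact: Dlin.
pose r' : {linear V -> sub_of T} :=
  HB.pack r (GRing.isLinear.Build k _ _ *:%R _ r_lin).
exists r' => t /=.
apply: r_uniq; rewrite subrr.
have := Dlin (-1) _ _ (rP 0) (rP 0); by rewrite scaleN1r addNr.
Qed.

End Complement.

Section TensorInj.
Variables (k : fieldType).

Lemma tmapK (A B V W : lmodType k) (f : {linear A -> V}) (f' : {linear V -> A})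
    (g : {linear B -> W}) (g' : {linear W -> B}) :
  cancel f f' -> cancel g g' -> cancel (tmap f g) (tmap f' g').
Proof.
move=> fK gK a; rewrite -[RHS]tlift_tensE linear_tlift.
by apply: eq_tlift => v w; rewrite /= tmap_tens fK gK.
Qed.

Variables (V W : lmodType k) (T : submodClosed V).

Lemma tmap_sub_val_injl : injective (tmap (@sub_val k V T) (@idfun W)).
Proof.
have [r rK] := sub_val_retraction T.
by apply: (can_inj (g := tmap r idfun)); apply: tmapK.
Qed.

Lemma tmap_sub_val_injr : injective (tmap (@idfun W) (@sub_val k V T)).
Proof.
have [r rK] := sub_val_retraction T.
by apply: (can_inj (g := tmap idfun r)); apply: tmapK.
Qed.
End TensorInj.

(** * Sweedler calculus in a Hopf algebra *)

Section Tmul.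
Variables (k : fieldType) (U : algType k).

Lemma mul_bilinear : bilinear (fun x y : U => x * y).
Proof. by lin. Qed.

HB.instance Definition _ :=
  GRing.isLinear.Build k (U ⊗ U)%type U *:%R (@tmul k U)
    (tlift_linear mul_bilinear).

Lemma tmul_tens (x y : U) : tmul (x ⊗ y) = x * y.
Proof. exact: (tlift_tens mul_bilinear). Qed.
End Tmul.

Lemma tlift_mull (k : fieldType) (U : algType k) (V W : lmodType k)
    (F : V -> W -> U) a y :
  tlift F a * y = tlift (fun v w => F v w * y) a.
Proof. exact: mulr_suml. Qed.

Section SweedlerHopf.
Variables (k : fieldType) (U : hopfAlgType k).
Implicit Types (x y : U) (P : lmodType k).

Lemma comulA_sum P (F : U -> U -> U -> P) x : trilinear F ->
  tlift (fun y z => tlift (fun y1 y2 => F y1 y2 z) (comul y)) (comul x) =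
  tlift (fun y z => tlift (F y) (comul z)) (comul x).
Proof. by move=> tF; apply: tlift_assoc (comulA x). Qed.

Lemma counit_suml P (h : U -> P) x : linear h ->
  tlift (fun y z => counit y *: h z) (comul x) = h x.
Proof.
move=> lh; rewrite -[in RHS](counitl x) (lin_tlift _ _ lh).
by apply: eq_tlift => y z; rewrite (scalable_linear lh).
Qed.

Lemma counit_sumr P (h : U -> P) x : linear h ->
  tlift (fun y z => counit z *: h y) (comul x) = h x.
Proof.
move=> lh; rewrite -[in RHS](counitr x) (lin_tlift _ _ lh).
by apply: eq_tlift => y z; rewrite (scalable_linear lh).
Qed.

Lemma comulM_sum P (F : U -> U -> P) x y : bilinear F ->
  tlift F (comul (x * y)) =
  tlift (fun x1 x2 =>
    tlift (fun y1 y2 => F (x1 * y1) (x2 * y2)) (comul y)) (comul x).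
Proof.
by move=> bF; rewrite comulM tlift_interchange //; apply: mul_bilinear.
Qed.

Lemma comul1_sum P (F : U -> U -> P) : bilinear F ->
  tlift F (comul 1) = F 1 1.
Proof. by move=> bF; rewrite comul1 tlift_tens. Qed.

Lemma antipode_suml x :
  tlift (fun y z => antipode y * z) (comul x) = (counit x)%:A.
Proof. by rewrite -antipodel /tmul tlift_tmap //; apply: mul_bilinear. Qed.

Lemma antipode_sumr x :
  tlift (fun y z => y * antipode z) (comul x) = (counit x)%:A.
Proof. by rewrite -antipoder /tmul tlift_tmap //; apply: mul_bilinear. Qed.

Lemma antipode1 : antipode (1 : U) = 1.
Proof.
have := antipode_suml 1; rewrite comul1_sum; last by lin.
by rewrite mulr1 counit1 scale1r.
Qed.

Lemma counit_alg (c : k) : counit (c%:A : U) = c.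
Proof. by rewrite linearZ /= counit1 mulr1. Qed.
End SweedlerHopf.

(** * The calculus on the tensor product of U and T *)

Section Calculus.
Variables (k : fieldType) (U : hopfAlgType k) (T : focc_subspace U).
Implicit Types (x y : U) (t : sub_of T) (P : lmodType k).

Lemma fsub_coact_linear : linear (@fsub_coact k U T).
Proof.
move=> c t t'; apply: (tmap_sub_val_injl (T := fsub T)).
by rewrite [RHS]linearP /= !fsub_coactP sub_val_linear !linearP.
Qed.

HB.instance Definition _ :=
  GRing.isLinear.Build k (sub_of T) (sub_of T ⊗ U)%type *:%R
    (@fsub_coact k U T) fsub_coact_linear.

Lemma aug_part1 : aug_part (1 : U) = 0.
Proof. by rewrite /aug_part counit1 scale1r subrr. Qed.

Lemma aug_partK x : x = aug_part x + (counit x)%:A.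
Proof. by rewrite subrK. Qed.

Lemma aug_part_sub t : aug_part (sub_val t) = sub_val t.
Proof.
by rewrite /aug_part (fsub_augmentation (valP t)) scale0r subr0.
Qed.

(** The coaction on T is only defined through its image in U ⊗ U; this is how
    it is computed, in sums whose terms make sense on U ⊗ U. *)
Lemma fsub_coact_sum P (F : U -> U -> P) t : bilinear F ->
  tlift (fun s y => F (sub_val s) y) (fsub_coact t) =
  tlift (fun y z => F (aug_part y) z) (comul (sub_val t)).
Proof.
move=> bF; have := congr1 (tlift F) (fsub_coactP t).
by rewrite !tlift_tmap.
Qed.

Lemma comul_aug_sum P (F : U -> U -> P) x :
  bilinear F -> (forall y, F 1 y = 0) ->
  tlift F (comul (aug_part x)) = tlift F (comul x).
Proof.
move=> bF F1; rewrite [in RHS](aug_partK x) addrC linearP comul1.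
by rewrite tlift_linear // tlift_tens // F1 scaler0 add0r.
Qed.

(** Applying t |-> t_(1)^+ ⊗ t_(2) twice amounts to applying the iterated
    comultiplication, because the correction term at the second step is
    1^+ ⊗ 1 = 0 (comul_aug_sum). *)
Lemma fsub_coactA t :
  tassoc (tmap (@fsub_coact k U T) idfun (fsub_coact t)) =
  tmap idfun comul (fsub_coact t).
Proof.
apply: (tmap_sub_val_injl (T := fsub T)).
rewrite [tassoc _]linear_tlift [LHS]linear_tlift [RHS]linear_tlift /=.
transitivity (tlift (fun s z => tlift (fun y1 y2 => aug_part y1 ⊗ (y2 ⊗ z))
    (comul (sub_val s))) (fsub_coact t)).
  apply: eq_tlift => s y /=.
  rewrite tassoc_tensl linear_tlift.
  rewrite -(fsub_coact_sum (F := fun a b => a ⊗ (b ⊗ y))); last by lin.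
  by apply: eq_tlift => s' y' /=; rewrite tmap_tens.
rewrite (fsub_coact_sum (F := fun a z =>
  tlift (fun y1 y2 => aug_part y1 ⊗ (y2 ⊗ z)) (comul a))); last by lin.
transitivity (tlift (fun a z => tlift (fun y1 y2 => aug_part y1 ⊗ (y2 ⊗ z))
    (comul a)) (comul (sub_val t))).
  apply: eq_tlift => y z; apply: comul_aug_sum; first by lin.
  by move=> w; rewrite aug_part1 linear0l.
rewrite (comulA_sum (F := fun a b c => aug_part a ⊗ (b ⊗ c)));
  last by split=> ? ?; lin.
transitivity (tlift (fun s y => sub_val s ⊗ comul y) (fsub_coact t)).
  rewrite (fsub_coact_sum (F := fun a y => a ⊗ comul y)); last by lin.
  apply: eq_tlift => y z; rewrite -[in RHS](tlift_tensE (comul z)).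
  by rewrite tlift_tensr.
by apply: eq_tlift => s y /=; rewrite tmap_tens.
Qed.

Lemma fsub_coact_counit P (h : sub_of T -> P) t : linear h ->
  tlift (fun s y => counit y *: h s) (fsub_coact t) = h t.
Proof.
move=> lh; have {2}<- : tlift (fun s y => counit y *: s) (fsub_coact t) = t.
  apply: (val_inj : injective (@sub_val k U T)).
  rewrite (linear_tlift (@sub_val k U T)).
  transitivity (tlift (fun s y => counit y *: sub_val s) (fsub_coact t)).
    by apply: eq_tlift => s y; apply: (linearZ_LR (@sub_val k U T)).
  rewrite (fsub_coact_sum (F := fun s y => counit y *: s)); last by lin.
  by rewrite counit_sumr ?aug_part_sub //; apply: linearP.
rewrite (lin_tlift _ _ lh).
by apply: eq_tlift => s y; rewrite (scalable_linear lh).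
Qed.

(** The structure maps of focc_of T, named so that they can carry their linear
    structures. *)
Definition calc_lco (w : U ⊗ sub_of T) : U ⊗ (U ⊗ sub_of T) :=
  tassoc (tmap comul idfun w).
Definition calc_rco : U ⊗ sub_of T -> (U ⊗ sub_of T) ⊗ U :=
  tlift (fun x t =>
    tmap idfun (@tmul k U) (tinterchange (comul x ⊗ fsub_coact t))).
Definition calc_codiff : U ⊗ sub_of T -> U :=
  tlift (fun x t => x * sub_val t).

Lemma calc_lco_linear : linear calc_lco.
Proof. by rewrite /calc_lco; lin. Qed.
HB.instance Definition _ :=
  GRing.isLinear.Build k _ _ *:%R calc_lco calc_lco_linear.

Lemma calc_rco_bilinear : bilinear (fun x t =>
  tmap idfun (@tmul k U) (tinterchange (comul x ⊗ fsub_coact t))).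
Proof. by lin. Qed.
HB.instance Definition _ :=
  GRing.isLinear.Build k _ _ *:%R calc_rco (tlift_linear calc_rco_bilinear).

Lemma calc_codiff_bilinear : bilinear (fun x t => x * sub_val t).
Proof. by lin. Qed.
HB.instance Definition _ :=
  GRing.isLinear.Build k _ _ *:%R calc_codiff
    (tlift_linear calc_codiff_bilinear).

Lemma calc_lco_tens x t :
  calc_lco (x ⊗ t) = tlift (fun x1 x2 => x1 ⊗ (x2 ⊗ t)) (comul x).
Proof. by rewrite /calc_lco tmap_tens tassoc_tensl. Qed.

Lemma calc_rco_tens x t :
  calc_rco (x ⊗ t) = tlift (fun x1 x2 =>
    tlift (fun s y => (x1 ⊗ s) ⊗ (x2 * y)) (fsub_coact t)) (comul x).
Proof.
rewrite /calc_rco (tlift_tens calc_rco_bilinear) tinterchangeE linear_tlift.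
apply: eq_tlift => x1 x2; rewrite linear_tlift; apply: eq_tlift => s y /=.
by rewrite tmap_tens /= tmul_tens.
Qed.

Lemma calc_codiff_tens x t : calc_codiff (x ⊗ t) = x * sub_val t.
Proof. exact: (tlift_tens calc_codiff_bilinear). Qed.

Lemma calc_rco_sum P (F : U ⊗ sub_of T -> U -> P) x t : bilinear F ->
  tlift F (calc_rco (x ⊗ t)) = tlift (fun x1 x2 =>
    tlift (fun s y => F (x1 ⊗ s) (x2 * y)) (fsub_coact t)) (comul x).
Proof.
move=> bF; rewrite calc_rco_tens tlift_tlift //; apply: eq_tlift => x1 x2.
by rewrite tlift_tlift //; apply: eq_tlift => s y; rewrite tlift_tens.
Qed.

Lemma calc_lco_sum P (F : U -> U ⊗ sub_of T -> P) x t : bilinear F ->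
  tlift F (calc_lco (x ⊗ t)) = tlift (fun x1 x2 => F x1 (x2 ⊗ t)) (comul x).
Proof.
move=> bF; rewrite calc_lco_tens tlift_tlift //; apply: eq_tlift => x1 x2.
by rewrite tlift_tens.
Qed.

Lemma calc_lcoA w :
  tassoc (tmap comul idfun (calc_lco w)) = tmap idfun calc_lco (calc_lco w).
Proof.
move: w; apply: tensor_linear_ext => [||x t]; [by lin|by lin|].
rewrite [tassoc _]linear_tlift calc_lco_sum; last by lin.
rewrite [RHS]calc_lco_sum; last by lin.
transitivity (tlift (fun x1 x2 =>
  tlift (fun y z => y ⊗ (z ⊗ (x2 ⊗ t))) (comul x1)) (comul x)).
  by apply: eq_tlift => x1 x2; rewrite /= tassoc_tensl.
rewrite (comulA_sum (F := fun a b c => a ⊗ (b ⊗ (c ⊗ t))));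
  last by split=> ? ?; lin.
by apply: eq_tlift => x1 x2; rewrite /= calc_lco_tens tlift_tensr.
Qed.

(** The right coaction is the diagonal one on the tensor product of the right
    comodules U and T: its coassociativity splits into those of comul and of
    fsub_coact. *)
Lemma calc_rcoA w :
  tassoc (tmap calc_rco idfun (calc_rco w)) = tmap idfun comul (calc_rco w).
Proof.
move: w; apply: tensor_linear_ext => [||x t]; [by lin|by lin|].
rewrite [tassoc _]linear_tlift calc_rco_sum; last by lin.
rewrite [RHS]calc_rco_sum; last by lin.
pose F (y z z' : U) : (U ⊗ sub_of T) ⊗ (U ⊗ U) := tlift (fun s u =>
  tlift (fun r v => (y ⊗ r) ⊗ ((z * v) ⊗ (z' * u))) (fsub_coact s))
    (fsub_coact t).
transitivity
  (tlift (fun x1 x2 => tlift (fun y z => F y z x2) (comul x1)) (comul x)).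
  apply: eq_tlift => x1 x2; rewrite exchange_tlift; apply: eq_tlift => s u /=.
  rewrite tassoc_tensl calc_rco_sum //; last by lin.
rewrite (comulA_sum (F := F)); last by rewrite /F; split=> ? ?; lin.
apply: eq_tlift => x1 x2.
under [LHS]eq_tlift => y z.
  rewrite /F (tlift_assoc (F := fun r v u => (x1 ⊗ r) ⊗ ((y * v) ⊗ (z * u)))
    _ (fsub_coactA t)); last by split=> ? ?; lin.
  over.
rewrite exchange_tlift; apply: eq_tlift => s u /=.
rewrite -[comul (x2 * u)]tlift_tensE comulM_sum; last by lin.
rewrite tlift_tensr; apply: eq_tlift => y z.
by rewrite tlift_tensr.
Qed.

Lemma calc_lco_counit w : tscalel counit (calc_lco w) = w.
Proof.
rewrite /tscalel.
move: w; apply: tensor_linear_ext => [||x t]; [by lin|by lin|].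
rewrite calc_lco_sum; last by lin.
by rewrite (counit_suml (h := fun x => x ⊗ t)) //; lin.
Qed.

Lemma calc_rco_counit w : tscaler counit (calc_rco w) = w.
Proof.
rewrite /tscaler.
move: w; apply: tensor_linear_ext => [||x t]; [by lin|by lin|].
rewrite calc_rco_sum; last by lin.
under eq_tlift => x1 x2.
  under eq_tlift => s y do rewrite counitM -scalerA scalerA mulrC -scalerA.
  rewrite (fsub_coact_counit (h := fun s => counit x2 *: (x1 ⊗ s)));
    last by lin.
  over.
by rewrite (counit_sumr (h := fun x => x ⊗ t)) //; lin.
Qed.

Lemma calc_lco_rco w :
  tassoc (tmap calc_lco idfun (calc_rco w)) = tmap idfun calc_rco (calc_lco w).
Proof.
move: w; apply: tensor_linear_ext => [||x t]; [by lin|by lin|].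
rewrite [tassoc _]linear_tlift calc_rco_sum; last by lin.
rewrite [RHS]calc_lco_sum; last by lin.
transitivity (tlift (fun x1 x2 => tlift (fun y z =>
   tlift (fun s u => y ⊗ ((z ⊗ s) ⊗ (x2 * u)))
     (fsub_coact t)) (comul x1)) (comul x)).
  apply: eq_tlift => x1 x2; rewrite exchange_tlift; apply: eq_tlift => s u /=.
  by rewrite tassoc_tensl calc_lco_sum //; lin.
rewrite (comulA_sum (F := fun a b c =>
  tlift (fun s u => a ⊗ ((b ⊗ s) ⊗ (c * u))) (fsub_coact t)));
  last by split=> ? ?; lin.
apply: eq_tlift => x1 x2 /=; rewrite calc_rco_tens tlift_tensr.
by apply: eq_tlift => y z; rewrite tlift_tensr.
Qed.

(** The two summands are x_(1) t_(1)^+ ⊗ x_(2) t_(2) and x_(1) ⊗ x_(2) t; the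
    second one restores the part epsilon(t_(1)) 1 removed by the augmentation in
    the first. *)
Lemma calc_coderivation w :
  comul (calc_codiff w) =
  tmap calc_codiff idfun (calc_rco w) + tmap idfun calc_codiff (calc_lco w).
Proof.
move: w; apply: tensor_linear_ext => [|c u v|x t]; first by lin.
  by rewrite !linearP scalerDr addrACA.
rewrite calc_codiff_tens -[LHS]tlift_tensE comulM_sum; last by lin.
rewrite [X in X + _]calc_rco_sum; last by lin.
rewrite [X in _ + X]calc_lco_sum; last by lin.
rewrite -tliftD; apply: eq_tlift => x1 x2 /=.
under [X in X + _]eq_tlift => s y do rewrite /= calc_codiff_tens.
rewrite calc_codiff_tens.
rewrite (fsub_coact_sum (F := fun s y => (x1 * s) ⊗ (x2 * y))); last by lin.
rewrite -[x1 ⊗ (x2 * _)](counit_suml (h := fun z => x1 ⊗ (x2 * z)));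
  last by lin.
rewrite -tliftD; apply: eq_tlift => y z /=.
by rewrite {1}(aug_partK y) mulrDr -scalerAr mulr1 linearDl linearZl_LR.
Qed.

(** The map x ⊗ t |-> x_(1) ⊗ x_(2) t is undone by
    y ⊗ z |-> y_(1) ⊗ S(y_(2)) z, up to the inclusion of U ⊗ T in U ⊗ U. *)
Lemma calc_codiff_injective :
  injective (fun w => tmap idfun calc_codiff (calc_lco w)).
Proof.
pose H (y z : U) : U ⊗ U :=
  tlift (fun y1 y2 => y1 ⊗ (antipode y2 * z)) (comul y).
suff HK w : tlift H (tmap idfun calc_codiff (calc_lco w)) =
            tmap idfun (@sub_val k U T) w.
  by move=> w w' /(congr1 (tlift H)); rewrite !HK; apply: tmap_sub_val_injr.
have bH : bilinear H by rewrite /H; lin.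
move: w; apply: tensor_linear_ext => [||x t]; [by rewrite /H; lin|by lin|].
rewrite tlift_tmap // /H calc_lco_sum; last by lin.
rewrite tmap_tens /=.
under eq_tlift do rewrite calc_codiff_tens.
rewrite (comulA_sum (F := fun a b c => a ⊗ (antipode b * (c * sub_val t))));
  last by split=> ? ?; lin.
transitivity (tlift (fun y z => counit z *: (y ⊗ sub_val t)) (comul x)).
  apply: eq_tlift => y z; under eq_tlift do rewrite mulrA.
  rewrite -tlift_tensr -(tlift_mull (fun b c => antipode b * c)).
  by rewrite antipode_suml -scalerAl mul1r linearZr_LR.
by rewrite (counit_sumr (h := fun y => y ⊗ sub_val t)) //; lin.
Qed.

Definition calc_act x : U ⊗ sub_of T -> U ⊗ sub_of T :=
  tmap (fun y => x * y) idfun.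

Lemma calc_act_tens x y t : calc_act x (y ⊗ t) = (x * y) ⊗ t.
Proof. by rewrite /calc_act /tmap tlift_tens //; lin. Qed.

Lemma calc_act_bilinear : bilinear calc_act.
Proof.
by rewrite /calc_act /tmap; lin.
Qed.

HB.instance Definition _ x :=
  GRing.isLinear.Build k _ _ *:%R (calc_act x) (calc_act_bilinear.2 x).

Lemma calc_act1 w : calc_act 1 w = w.
Proof.
move: w; apply: tensor_linear_ext => [||x t]; [by lin|by lin|].
by rewrite !calc_act_tens mul1r.
Qed.

Lemma calc_actM x y w : calc_act (x * y) w = calc_act x (calc_act y w).
Proof.
move: w; apply: tensor_linear_ext => [||z t]; [by lin|by lin|].
by rewrite !calc_act_tens mulrA.
Qed.

Lemma calc_act_lco x w :
  calc_lco (calc_act x w) =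
  tmap (@tmul k U) (tlift calc_act) (tinterchange (comul x ⊗ calc_lco w)).
Proof.
have bm := calc_act_bilinear.
have lm := tlift_linear bm.
pose a : {linear (U ⊗ (U ⊗ sub_of T))%type -> _} :=
  HB.pack (tlift calc_act) (GRing.isLinear.Build k _ _ *:%R _ lm).
rewrite -[tlift _]/(a : _ -> _).
move: w; apply: tensor_linear_ext => [||y t]; [by lin|by lin|].
rewrite -[RHS]tlift_tensE tlift_interchange //; last by lin.
  rewrite calc_act_tens calc_lco_tens comulM_sum; last by lin.
  apply: eq_tlift => x1 x2; rewrite calc_lco_sum; last by lin.
  by apply: eq_tlift => y1 y2; rewrite calc_act_tens.
exact: mul_bilinear.
Qed.

Lemma calc_act_rco x w :
  calc_rco (calc_act x w) =
  tmap (tlift calc_act) (@tmul k U) (tinterchange (comul x ⊗ calc_rco w)).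
Proof.
have bm := calc_act_bilinear.
have lm := tlift_linear bm.
pose a : {linear (U ⊗ (U ⊗ sub_of T))%type -> _} :=
  HB.pack (tlift calc_act) (GRing.isLinear.Build k _ _ *:%R _ lm).
rewrite -[tlift _]/(a : _ -> _).
move: w; apply: tensor_linear_ext => [||y t]; [by lin|by lin|].
rewrite -[RHS]tlift_tensE tlift_interchange //; last by lin.
  rewrite calc_act_tens calc_rco_tens comulM_sum; last by lin.
  apply: eq_tlift => x1 x2; rewrite calc_rco_sum; last by lin.
  apply: eq_tlift => y1 y2; apply: eq_tlift => s z.
  by rewrite calc_act_tens mulrA.
exact: mul_bilinear.
Qed.

Lemma calc_act_codiff x w : calc_codiff (calc_act x w) = x * calc_codiff w.
Proof.
move: w; apply: tensor_linear_ext => [||y t]; [by lin|by lin|].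
by rewrite calc_act_tens !calc_codiff_tens mulrA.
Qed.

Lemma focc_of_efocc : is_efocc (focc_of T).
Proof.
split.
- split.
  + split; [exact: calc_lco_linear|exact: linearP calc_rco|exact: calc_lcoA
      |exact: calc_lco_counit|exact: calc_rcoA|exact: calc_rco_counit
      |exact: calc_lco_rco].
  + exact: linearP calc_codiff.
  + exact: calc_coderivation.
  + exact: calc_codiff_injective.
- exact: calc_act_bilinear.1.
- exact: calc_act_bilinear.2.
- exact: calc_act1.
- exact: calc_actM.
- exact: calc_act_lco.
- exact: calc_act_rco.
- exact: calc_act_codiff.
Qed.
End Calculus.

(** * Coinvariants of a left Hopf module *)

Section HopfModule.
Variables (k : fieldType) (U : hopfAlgType k) (W : lmodType k).
Variables (lco : {linear W -> (U ⊗ W)%type}) (a : {bilinear U -> W -> W}).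
Implicit Types (x y : U) (v w : W) (P : lmodType k).

Definition diag_act x (c : U ⊗ W) : U ⊗ W :=
  tlift (fun x1 x2 => tlift (fun y v => (x1 * y) ⊗ a x2 v) c) (comul x).

Hypothesis lcoA : forall w,
  tassoc (tmap comul idfun (lco w)) = tmap idfun lco (lco w).
Hypothesis lco_counit : forall w, tscalel counit (lco w) = w.
Hypothesis a1 : forall w, a 1 w = w.
Hypothesis aM : forall x y w, a (x * y) w = a x (a y w).
Hypothesis lco_act : forall x w, lco (a x w) = diag_act x (lco w).

Lemma lcoA_sum P (F : U -> U -> W -> P) w : trilinear F ->
  tlift (fun x v => tlift (fun y z => F y z v) (comul x)) (lco w) =
  tlift (fun x v => tlift (F x) (lco v)) (lco w).
Proof. by move=> tF; apply: tlift_assoc (lcoA w). Qed.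

Lemma lco_counit_sum P (h : W -> P) w : linear h ->
  tlift (fun x v => counit x *: h v) (lco w) = h w.
Proof.
move=> lh; rewrite -[in RHS](lco_counit w) (lin_tlift _ _ lh).
by apply: eq_tlift => x v; rewrite (scalable_linear lh).
Qed.

Lemma diag_act_bilinear : bilinear diag_act.
Proof. by rewrite /diag_act; lin. Qed.

Lemma diag_act_tens x y v :
  diag_act x (y ⊗ v) = tlift (fun x1 x2 => (x1 * y) ⊗ a x2 v) (comul x).
Proof. by apply: eq_tlift => x1 x2; rewrite tlift_tens //; lin. Qed.

Lemma diag_actM x y c : diag_act (x * y) c = diag_act x (diag_act y c).
Proof.
have bD := diag_act_bilinear.
pose D z : {linear (U ⊗ W)%type -> (U ⊗ W)%type} :=
  HB.pack (diag_act z) (GRing.isLinear.Build k _ _ *:%R _ (bD.2 z)).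
rewrite -[RHS]/(D x (D y c)) -[LHS]/(D (x * y) c).
move: c; apply: tensor_linear_ext => [||z v]; [by lin|by lin|].
rewrite /= !diag_act_tens -[RHS]/(D x _) linear_tlift comulM_sum; last by lin.
rewrite exchange_tlift; apply: eq_tlift => y1 y2.
rewrite /= diag_act_tens; apply: eq_tlift => x1 x2.
by rewrite mulrA aM.
Qed.

Lemma diag_act1 c : diag_act 1 c = c.
Proof.
rewrite /diag_act comul1_sum; last by lin.
rewrite -[RHS]tlift_tensE; apply: eq_tlift => y v.
by rewrite mul1r a1.
Qed.

(** The map w |-> S(w_(-1)) w_(0). *)
Definition coinv_proj w : W := tlift (fun x v => a (antipode x) v) (lco w).

Lemma coinv_proj_linear : linear coinv_proj.
Proof. by rewrite /coinv_proj; lin. Qed.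

HB.instance Definition _ :=
  GRing.isLinear.Build k W W *:%R coinv_proj coinv_proj_linear.

(** w_(-2) S(w_(-1)) w_(0) = w. *)
Lemma act_coinv_proj w :
  tlift (fun x v => a x (coinv_proj v)) (lco w) = w.
Proof.
transitivity
  (tlift (fun x v => tlift (fun y z => a (y * antipode z) v) (comul x))
     (lco w)).
  rewrite (lcoA_sum (F := fun y z v => a (y * antipode z) v));
    last by split=> ? ?; lin.
  apply: eq_tlift => x v.
  rewrite /coinv_proj (lin_tlift (f := a x)); last by lin.
  by apply: eq_tlift => y u; rewrite aM.
rewrite -[RHS](lco_counit_sum (h := id)) //; apply: eq_tlift => x v.
rewrite -(lin_tlift (f := a^~ v)); last by lin.
by rewrite antipode_sumr linearZl_LR /= a1.
Qed.

(** This avoids the formula for the comultiplication of an antipode.  Let E(w)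
    be the difference of the two sides and let U act diagonally on U ⊗ W.  Both
    w_(-1) . lco (coinv_proj w_(0)) and w_(-1) . (1 ⊗ coinv_proj w_(0)) are equal
    to lco w by act_coinv_proj, so that w_(-1) . E(w_(0)) = 0 for all w; then
    E(w) = S(w_(-2)) . w_(-1) . E(w_(0)) = 0. *)
Lemma lco_coinv_proj w : lco (coinv_proj w) = 1 ⊗ coinv_proj w.
Proof.
pose E v := lco (coinv_proj v) - 1 ⊗ coinv_proj v.
have lE : linear E.
  by move=> c u v; rewrite /E !linearP linearPr /= opprD addrACA -scalerBr.
pose D : {bilinear U -> (U ⊗ W)%type -> (U ⊗ W)%type} :=
  HB.pack diag_act
    (bilinear_isBilinear.Build k _ _ _ *:%R *:%R _ diag_act_bilinear).
pose E' : {linear W -> (U ⊗ W)%type} :=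
  HB.pack E (GRing.isLinear.Build k _ _ *:%R _ lE).
have DE v : tlift (fun x u => D x (E' u)) (lco v) = 0.
  transitivity (tlift (fun x u => lco (a x (coinv_proj u))) (lco v) -
     tlift (fun x u => diag_act x (1 ⊗ coinv_proj u)) (lco v)).
    rewrite -tliftB; apply: eq_tlift => x u; rewrite linearBr /=.
    by rewrite lco_act.
  rewrite -linear_tlift act_coinv_proj.
  apply/eqP; rewrite subr_eq0 eq_sym; apply/eqP.
  transitivity (tlift (fun x u =>
    tlift (fun y z => y ⊗ a z (coinv_proj u)) (comul x)) (lco v)).
    apply: eq_tlift => x u; rewrite diag_act_tens; apply: eq_tlift => y z.
    by rewrite mulr1.
  rewrite (lcoA_sum (F := fun y z u => y ⊗ a z (coinv_proj u)));
    last by split=> ? ?; lin.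
  rewrite -[RHS]tlift_tensE; apply: eq_tlift => x u.
  by rewrite -tlift_tensr act_coinv_proj.
apply/eqP; rewrite -subr_eq0 -[_ - _]/(E' w); apply/eqP.
rewrite -[LHS](lco_counit_sum (h := E')); last by lin.
transitivity (tlift (fun x v =>
  tlift (fun y z => D (antipode y * z) (E' v)) (comul x)) (lco w)).
  apply: eq_tlift => x v; rewrite -(lin_tlift (f := D^~ (E' v))); last by lin.
  by rewrite antipode_suml linearZl_LR /= diag_act1.
rewrite (lcoA_sum (F := fun y z v => D (antipode y * z) (E' v)));
  last by split=> ? ?; lin.
transitivity (tlift (fun (x : U) (v : W) => 0 : U ⊗ W) (lco w));
  last exact: big1_eq.
apply: eq_tlift => x v; rewrite -[RHS](linear0r D (antipode x)) -(DE v).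
rewrite (lin_tlift (f := D (antipode x))); last by lin.
by apply: eq_tlift => y u; apply: diag_actM.
Qed.

Lemma coinv_proj_id w : lco w = 1 ⊗ w -> coinv_proj w = w.
Proof.
by move=> lw; rewrite /coinv_proj lw tlift_tens ?antipode1 ?a1 //; lin.
Qed.

End HopfModule.

(** * The subspace attached to a calculus *)

Section Reconstruction.
Variables (k : fieldType) (U : hopfAlgType k) (W : efocc_data U).
Hypothesis hW : is_efocc W.
Implicit Types (x y : U) (v w : W).

Let bW := focc_bicomodule (efocc_is_focc hW).
Let lco : {linear W -> (U ⊗ W)%type} :=
  HB.pack (@lcoact k U W) (GRing.isLinear.Build k _ _ *:%R _ (lco_linear bW)).
Let rco : {linear W -> (W ⊗ U)%type} :=
  HB.pack (@rcoact k U W) (GRing.isLinear.Build k _ _ *:%R _ (rco_linear bW)).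
Let d : {linear W -> U} :=
  HB.pack (@codiff k U W)
    (GRing.isLinear.Build k _ _ *:%R _ (codiff_linear (efocc_is_focc hW))).
Let a : {bilinear U -> W -> W} :=
  HB.pack (@act k U W)
    (bilinear_isBilinear.Build k _ _ _ *:%R *:%R (@act k U W)
       (bilinearI (act_bilinear1 hW) (act_bilinear2 hW))).

Let lco_act x w : lco (a x w) = diag_act a x (lco w).
Proof.
rewrite -[LHS]/(lcoact (act x w)) (act_lcoact hW) -[LHS]tlift_tensE.
rewrite tlift_interchange //; [exact: mul_bilinear| |by lin].
exact: (bilinearI (act_bilinear1 hW) (act_bilinear2 hW)).
Qed.

Let p : {linear W -> W} := coinv_proj lco a.

Let lco_p w : lco (p w) = 1 ⊗ p w.
Proof.
exact: (lco_coinv_proj (lco := lco) (a := a)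
  (lcoA bW) (lco_counit bW) (act1 hW) (actM hW) lco_act).
Qed.

Let p_id w : lco w = 1 ⊗ w -> p w = w.
Proof. exact: (coinv_proj_id (lco := lco) (a := a) (act1 hW)). Qed.

Let act_p w : tlift (fun x v => a x (p v)) (lco w) = w.
Proof.
exact: (act_coinv_proj (lco := lco) (a := a)
  (lcoA bW) (lco_counit bW) (act1 hW) (actM hW)).
Qed.

Let d_comul w : comul (d w) = tmap d idfun (rco w) + tmap idfun d (lco w).
Proof. exact: (codiff_coderivation (efocc_is_focc hW)). Qed.

(** Applying counits to the coderivation rule gives
    epsilon(d(w)) = epsilon(d(w)) + epsilon(d(w)).  The right counit is applied
    first, which leaves epsilon(d(w_(0))) w_(-1) = 0. *)
Lemma codiff_counit w : counit (codiff w) = 0.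
Proof.
have bF : bilinear (fun x y : U => counit y *: x) by lin.
have := congr1 (tlift (fun x y : U => counit y *: x)) (d_comul w).
rewrite (counit_sumr (h := id)) //.
pose G : {linear (U ⊗ U)%type -> U} :=
  HB.pack (tlift (fun x y : U => counit y *: x))
    (GRing.isLinear.Build k _ _ *:%R _ (tlift_linear bF)).
rewrite -[RHS]/(G _) linearD /= !tlift_tmap // /=.
have -> : tlift (fun v y => counit y *: d v) (rco w) = d w.
  rewrite -[in RHS](rco_counit bW w) /tscaler linear_tlift.
  by apply: eq_tlift => v y; rewrite linearZ.
move/eqP; rewrite addrC -subr_eq subrr eq_sym => /eqP.
(* The counit is composed with the unit of U to be valued in a module over k. *)
move/(congr1 (fun x : U => (counit x)%:A : U)).
rewrite linear0 scale0r (lin_tlift (f := fun x : U => (counit x)%:A));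
  last by lin.
move=> e; rewrite -[LHS](counit_alg U) -[codiff w]/(d w).
rewrite -[(counit (d w))%:A](lco_counit_sum (lco := lco) (lco_counit bW)
  (h := fun v => (counit (d v))%:A)); last by lin.
rewrite -[RHS](linear0 (counit : {scalar U})) -e; congr (counit _).
by apply: eq_tlift => x v; rewrite scalerA [in RHS]linearZ mulrC.
Qed.

(** On coinvariants the injectivity axiom concerns w |-> 1 ⊗ d(w). *)
Lemma codiff_coinv_inj w : d (p w) = 0 -> p w = 0.
Proof.
move=> dpw; apply: (codiff_injective (efocc_is_focc hW)).
rewrite -[LHS]/(tmap idfun d (lco (p w))) -[RHS]/(tmap idfun d (lco 0)).
by rewrite lco_p tmap_tens dpw !linear0 linear0r.
Qed.

(** The right coaction preserves coinvariants: since the coactions commute, the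
    map v |-> S(v_(-1)) v_(0) in the first factor of rco (p w) only sees the left
    coaction 1 ⊗ p w. *)
Lemma rco_coinv w : tmap p idfun (rco (p w)) = rco (p w).
Proof.
pose F x (c : W ⊗ U) := tlift (fun v y => a (antipode x) v ⊗ y) c.
have bF : bilinear F by rewrite /F; lin.
have e : tassoc (tmap lco idfun (rco (p w))) = tmap idfun rco (lco (p w)).
  exact: lco_rco bW (p w).
have {e} := congr1 (tlift F) e.
rewrite lco_p tmap_tens tlift_tens // [tassoc _]linear_tlift tlift_tlift //.
move=> e.
transitivity (F 1 (rco (p w))); last first.
  rewrite /F antipode1 -[RHS]tlift_tensE; apply: eq_tlift => v y.
  by rewrite /= (act1 hW).
rewrite -[RHS]e; apply: eq_tlift => v y; rewrite /= tassoc_tensl tlift_tlift //.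
rewrite tlift_tensl; apply: eq_tlift => x u.
by rewrite tlift_tens // /F tlift_tens //; lin.
Qed.

(* The image under d of the coinvariants, which are the image of p.           *)
Let Tpred : {pred U} := fun u => `[< exists w, d (p w) = u >].

Let Tpred_closed : subsemimod_closed Tpred.
Proof.
split.
  split; first by apply/asboolP; exists 0; rewrite !linear0.
  move=> _ _ /asboolP [v <-] /asboolP [w <-]; apply/asboolP; exists (v + w).
  by rewrite !linearD.
move=> c _ /asboolP [v <-]; apply/asboolP; exists (c *: v).
by rewrite !linearZ.
Qed.

Let Tsub : submodClosed U :=
  HB.pack Tpred (GRing.isSubmodClosed.Build k U Tpred Tpred_closed).

Let Tsub_augmentation t : t \in Tsub -> counit t = 0.
Proof. by move=> /asboolP [w <-]; apply: codiff_counit. Qed.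

Let d_comul_p w :
  comul (d (p w)) = tmap d idfun (rco (p w)) + 1 ⊗ d (p w).
Proof. by rewrite d_comul lco_p tmap_tens. Qed.

Let Tsub_comul t : t \in Tsub -> tensor_subl (add_unit Tsub) (comul t).
Proof.
move=> /asboolP [w <-]; rewrite d_comul_p -rco_coinv.
exists (rcons [seq (d (p q.1), q.2) | q <- repr (rco (p w))] (1, d (p w))).
split.
  move=> q; rewrite mem_rcons inE => /orP [/eqP -> /=|/mapP [r _ ->] /=].
    by exists 0, 1; rewrite rpred0 scale1r add0r.
  exists (d (p r.1)), 0; rewrite scale0r addr0; split=> //.
  by apply/asboolP; exists r.1.
rewrite -cats1 big_cat big_seq1 big_map; congr (_ + _).
by rewrite linear_tlift; apply: eq_bigr => q _; apply: tmap_tens.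
Qed.

Definition coinv_subspace : focc_subspace U :=
  FoccSubspace Tsub_augmentation Tsub_comul.

Let T := coinv_subspace.

Let Tsub_p w : d (p w) \in T.
Proof. by apply/asboolP; exists w. Qed.

Let q w : sub_of T := SubOf (Tsub_p w).

Let q_linear : linear q.
Proof.
move=> c u v; apply: val_inj.
by rewrite [RHS]sub_val_linear -[LHS]/(d (p _)) !linearP.
Qed.

Let ql : {linear W -> sub_of T} :=
  HB.pack q (GRing.isLinear.Build k _ _ *:%R _ q_linear).

Let p_dinj v w : d (p v) = d (p w) -> p v = p w.
Proof.
move=> e; apply/eqP; rewrite -subr_eq0 -linearB; apply/eqP/codiff_coinv_inj.
by rewrite !linearB e subrr.
Qed.

(** The inverse of the coderivation on coinvariants. *)
Lemma coinv_section : exists s : {linear sub_of T -> W},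
  [/\ forall t, d (s t) = sub_val t, forall t, lco (s t) = 1 ⊗ s t
    & forall w, s (ql w) = p w].
Proof.
have /choice [r dr] : forall t : sub_of T, exists w, d (p w) = sub_val t.
  by move=> t; have /asboolP := valP t.
have s_lin : linear (p \o r).
  move=> c t t'; rewrite /= -[RHS](linearP p); apply: p_dinj.
  by rewrite dr sub_val_linear !linearP !dr.
exists (HB.pack_for {linear sub_of T -> W} (p \o r)
  (GRing.isLinear.Build k _ _ *:%R _ s_lin)); split=> [t|t|w].
- exact: dr.
- exact: lco_p.
- by apply: p_dinj; rewrite dr.
Qed.

Section Iso.
Variable s : {linear sub_of T -> W}.
Hypothesis d_s : forall t, d (s t) = sub_val t.
Hypothesis lco_s : forall t, lco (s t) = 1 ⊗ s t.
Hypothesis s_q : forall w, s (ql w) = p w.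

(* Both sides have their first factor in the coinvariants, where d is         *)
(* injective, and d ⊗ id takes both to Delta(t) - 1 ⊗ t.                      *)
Let rco_s t : rco (s t) = tmap s idfun (fsub_coact t).
Proof.
have p_s : p (s t) = s t by apply: p_id.
suff <- : tmap ql idfun (rco (s t)) = fsub_coact t.
  rewrite -[in LHS]p_s -rco_coinv p_s [RHS]linear_tlift.
  by apply: eq_tlift => v y; rewrite [RHS]tmap_tens s_q.
apply: (tmap_sub_val_injl (T := fsub T)); rewrite fsub_coactP.
transitivity (tmap d idfun (rco (s t))).
  rewrite -[in RHS]p_s -rco_coinv p_s [RHS]linear_tlift [LHS]linear_tlift.
  apply: eq_tlift => v y; transitivity (d (p v) ⊗ y); first exact: tmap_tens.
  exact/esym/tmap_tens.
apply: (addIr (1 ⊗ d (s t))); have := d_comul_p (s t).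
rewrite p_s => <-; rewrite d_s.
rewrite -[LHS]tlift_tensE -[in RHS](counit_suml (h := fun y => 1 ⊗ y));
  last by lin.
rewrite /tmap -tliftD; apply: eq_tlift => y z.
by rewrite {1}(aug_partK y) linearDl /= linearZl_LR.
Qed.

Let g_bilinear : bilinear (fun x t => a x (s t)).
Proof. by lin. Qed.

Let g : {linear (U ⊗ sub_of T)%type -> W} :=
  HB.pack (tlift (fun x t => a x (s t)))
    (GRing.isLinear.Build k _ _ *:%R _ (tlift_linear g_bilinear)).

Let g_tens x t : g (x ⊗ t) = a x (s t).
Proof. exact: tlift_tens. Qed.

(** The isomorphism is x ⊗ t |-> x (s t).  It is injective because it
    intertwines the maps of the injectivity axiom, and that of U ⊗ T is
    injective; it is surjective since w = w_(-1) (p w_(0)). *)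
Lemma reconstruction_iso : efocc_iso (focc_of T) W.
Proof.
have g_act x c : g (calc_act x c) = a x (g c).
  move: c; apply: tensor_linear_ext => [||y t]; [by lin|by lin|].
  by rewrite calc_act_tens !g_tens; apply: (actM hW).
have g_lco c : lco (g c) = tmap idfun g (calc_lco c).
  move: c; apply: tensor_linear_ext => [||x t]; [by lin|by lin|].
  rewrite g_tens lco_act lco_s diag_act_tens calc_lco_tens linear_tlift.
  apply: eq_tlift => x1 x2.
  by rewrite mulr1 [RHS]tmap_tens g_tens.
have g_rco c : rco (g c) = tmap g idfun (calc_rco c).
  move: c; apply: tensor_linear_ext => [||x t]; [by lin|by lin|].
  rewrite g_tens -[LHS]/(rcoact (act x (s t))) (act_rcoact hW).
  rewrite -[rcoact _]/(rco (s t)) rco_s.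
  have bact := bilinearI (act_bilinear1 hW) (act_bilinear2 hW).
  have bmul := mul_bilinear U.
  rewrite -[LHS]tlift_tensE tlift_interchange //; last by lin.
  rewrite calc_rco_tens [RHS]linear_tlift; apply: eq_tlift => x1 x2.
  rewrite [RHS]linear_tlift.
  rewrite (tlift_tmap _ _ (F := fun v y => a x1 v ⊗ (x2 * y))); last by lin.
  apply: eq_tlift => u y.
  by rewrite [RHS]tmap_tens g_tens.
have g_d c : d (g c) = calc_codiff c.
  move: c; apply: tensor_linear_ext => [||x t]; [by lin|by lin|].
  by rewrite g_tens calc_codiff_tens -d_s; apply: (act_codiff hW).
have g_inj : injective g.
  move=> b c e; apply: (calc_codiff_injective (T := T)).
  have E (c0 : U ⊗ sub_of T) : tmap idfun (@calc_codiff k U T) (calc_lco c0) =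
                               tmap idfun d (lco (g c0)).
    rewrite g_lco [RHS]linear_tlift; apply: eq_tlift => x v'.
    by rewrite [RHS]tmap_tens g_d.
  by rewrite !E e.
have g_surj w : exists c, g c = w.
  exists (tmap idfun ql (lco w)).
  rewrite -[RHS]act_p linear_tlift; apply: eq_tlift => x v.
  by rewrite [LHS]g_tens s_q.
exists g; split=> //.
have /choice [h hP] := g_surj.
by exists h => // w; apply: g_inj; rewrite hP.
Qed.
End Iso.
End Reconstruction.

(** * Isomorphic calculi have the same subspace *)

Section IsoTheory.
Variables (k : fieldType) (U : hopfAlgType k).

Lemma efocc_iso_refl (W : efocc_data U) : efocc_iso W W.
Proof.
have tmap_id (A B : lmodType k) (c : A ⊗ B) : tmap idfun idfun c = c.
  exact: tlift_tensE.
exists (GRing.ssrfun_idfun__canonical__GRing_Linear W); split=> //.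
  by exists idfun.
Qed.

Lemma efocc_iso_sym (W W' : efocc_data U) : efocc_iso W W' -> efocc_iso W' W.
Proof.
case=> f [[h fK hK] f_act f_lco f_rco f_d].
have h_lin : linear h.
  by move=> c u v; apply: (can_inj fK); rewrite linearP !hK.
pose hl : {linear W' -> W} :=
  HB.pack h (GRing.isLinear.Build k _ _ *:%R _ h_lin).
exists hl; split=> [|x w|w|w|w].
- by exists f.
- by apply: (can_inj fK); rewrite f_act !hK.
- rewrite -{2}[w]hK f_lco.
  by rewrite (tmapK (f := idfun) (f' := idfun) (g := f) (g' := hl)).
- rewrite -{2}[w]hK f_rco.
  by rewrite (tmapK (f := f) (f' := hl) (g := idfun) (g' := idfun)).
- by rewrite -f_d hK.
Qed.

(** Applying the counit to the middle factor of
    x_(1) ⊗ (x_(2) ⊗ t) = 1 ⊗ (x ⊗ t). *)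
Lemma calc_coinv (T : focc_subspace U) (c : U ⊗ sub_of T) :
  calc_lco c = 1 ⊗ c -> exists t, c = 1 ⊗ t.
Proof.
pose e (b : U ⊗ sub_of T) : sub_of T := tlift (fun x t => counit x *: t) b.
have be : bilinear (fun (x : U) (t : sub_of T) => counit x *: t) by lin.
have eE b : tmap idfun e (calc_lco b) = b.
  rewrite /e; move: b; apply: tensor_linear_ext => [||x t].
  - by rewrite /tmap; lin.
  - by lin.
  rewrite /tmap calc_lco_sum; last by lin.
  under eq_tlift => x1 x2 do rewrite tlift_tens // linearZr_LR.
  by rewrite (counit_sumr (h := fun x => x ⊗ t)) //; lin.
move=> lc; exists (e c); rewrite -[LHS]eE lc /tmap tlift_tens //.
by rewrite /e; lin.
Qed.

(** An isomorphism sends 1 ⊗ t to a coinvariant, 1 ⊗ t', with the same image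
    under the coderivation, that is t' = t. *)
Lemma iso_subset (T T' : focc_subspace U) :
  efocc_iso (focc_of T) (focc_of T') -> {subset fsub T <= fsub T'}.
Proof.
case=> f [_ _ f_lco _ f_d] u Tu; pose t : sub_of T := SubOf Tu.
have [|t' ft] := @calc_coinv T' (f (1 ⊗ t)).
  apply: etrans (f_lco _) _.
  rewrite -[lcoact _]/(calc_lco _) calc_lco_tens comul1_sum ?tmap_tens //; lin.
have : calc_codiff (1 ⊗ t') = calc_codiff (1 ⊗ t) by rewrite -ft; apply: f_d.
rewrite !calc_codiff_tens !mul1r /= => <-.
exact: valP t'.
Qed.

Lemma focc_subspace_eq (T T' : focc_subspace U) : fsub T =i fsub T' -> T = T'.
Proof.
case: T T' => [[S [[SD] [SZ]]] aug com] [[S1 [[SD1] [SZ1]]] aug1 com1] /= eqS.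
have {eqS} eqS : S = S1 by apply: funext => x; apply: eqS.
subst S1; move: aug com.
rewrite (Prop_irrelevance SD SD1) (Prop_irrelevance SZ SZ1) => aug com.
by rewrite (Prop_irrelevance aug aug1) (Prop_irrelevance com com1).
Qed.
End IsoTheory.

Theorem corollary5p8 (k : fieldType) (k_char : 2%N \notin [pchar k])
    (U : hopfAlgType k) :
  [/\ forall T : focc_subspace U, is_efocc (focc_of T),
      forall W : efocc_data U,
        is_efocc W -> exists T : focc_subspace U, efocc_iso W (focc_of T)
    & forall T T' : focc_subspace U,
        efocc_iso (focc_of T) (focc_of T') <-> fsub T =i fsub T'].
Proof.
split=> [T|W hW|T T'].
- exact: focc_of_efocc.
- exists (coinv_subspace hW); apply: efocc_iso_sym.
  have [s [d_s lco_s s_q]] := coinv_section hW.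
  exact: reconstruction_iso d_s lco_s s_q.
split=> [iso x|/focc_subspace_eq ->]; last exact: efocc_iso_refl.
by apply/idP/idP; apply: iso_subset => //; apply: efocc_iso_sym.
Qed.
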